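(* Let $m$ be a positive integer, $n=2m$, let $d$ be a positive divisor of $2^m+1$ and $l$ a positive integer with $\gcd(l,\frac{2^m+1}{d})=1$. Let $a_0\in\mathbb{F}_{2^m}^*$, $a_1=a_2=\cdots=a_{d-1}\in\mathbb{F}_{2^m}$ with $a_0\neq a_1$, and define $f:\mathbb{F}_{2^n}\to\mathbb{F}_2$ by $$f(x)=\sum_{i=0}^{d-1}{\rm Tr}_1^n\big(a_ix^{(l+i\frac{2^m+1}{d})(2^m-1)}\big).$$ Then $f$ is bent if and only if $$K_m(a_0)+(d-1)K_m(a_0+a_1)=\begin{cases}2\big(E_{m,d}(a_0)+(d-1)E_{m,d}(a_0+a_1)\big),& \text{if } d\mid l;\\ 2\big(E_{m,d}(a_0)-E_{m,d}(a_0+a_1)\big),&\text{if }\gcd(d,l)=1.\end{cases}$$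
   Context: ${\rm Tr}_k^t$ is the trace map from $\mathbb{F}_{2^t}$ to $\mathbb{F}_{2^k}$. A function $f:\mathbb{F}_{2^n}\to\mathbb{F}_2$ is bent if $|W_f(\lambda)|^2=2^n$ for all $\lambda$, where $W_f(\lambda)=\sum_{x\in\mathbb{F}_{2^n}}(-1)^{f(x)+{\rm Tr}_1^n(\lambda x)}$. The Kloosterman sum is $K_m(\beta)=\sum_{x\in\mathbb{F}_{2^m}}(-1)^{{\rm Tr}_1^m(\beta x+x^{2^m-2})}$. The Dickson polynomial $D_r(x)\in\mathbb{F}_2[x]$ is $D_r(x)=\sum_{i=0}^{\lfloor r/2\rfloor}\frac{r}{r-i}\binom{r-i}{i}x^{r-2i}$ (integer coefficients reduced mod 2), and $E_{m,d}(\beta)=\sum_{x\in\mathbb{F}_{2^m}}(-1)^{{\rm Tr}_1^m(\beta D_d(x))}$.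
   Formalization: In the Kloosterman sum, x^{2^m-2} is read as the inverse of x with 0 sent to 0; this differs from the literal power only for m=1, where reading x^0 as 1 makes the claim false (m=d=l=1, a_0=1, a_1=0: both sides are 0 but f=Tr(x) is linear, not bent). *)

(* Defs.v *)
From mathcomp Require Import all_boot all_order all_algebra all_field.
Set Implicit Arguments. Unset Strict Implicit. Unset Printing Implicit Defensive.
Import GRing.Theory Num.Theory.
Local Open Scope ring_scope.

Section Defs.
Variable L : finFieldType.

Definition inSub (k : nat) (x : L) : bool := x ^+ (2 ^ k) == x.

Definition trace1 (k : nat) (x : L) : L := \sum_(i < k) x ^+ (2 ^ i).

(* (-1)^t for t in F_2 (seen inside L) *)
Definition sgn (t : L) : int := if t == 0 then 1 else -1.

(* Walsh transform of f : L -> F_2 (values in {0,1} of L), with L = F_{2^n} *)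
Definition walsh (n : nat) (f : L -> L) (lam : L) : int :=
  \sum_(x : L) sgn (f x + trace1 n (lam * x)).

Definition bent (n : nat) (f : L -> L) : Prop :=
  forall lam : L, (walsh n f lam) ^+ 2 = (2 ^ n)%:Z.

(* Kloosterman sum over F_{2^m}; x^{2^m-2} is the inverse map with 0 |-> 0 *)
Definition kloosterman (m : nat) (beta : L) : int :=
  \sum_(x : L | inSub m x) sgn (trace1 m (beta * x + x^-1)).

(* Dickson polynomial coefficient  r/(r-i) * binom(r-i, i)  (an integer) *)
Definition dickson_coef (r i : nat) : nat := ((r * 'C(r - i, i)) %/ (r - i))%N.

(* D_r(x), coefficients reduced mod 2 (L has characteristic 2) *)
Definition dickson (r : nat) (x : L) : L :=
  \sum_(i < (r %/ 2).+1) ((dickson_coef r i %% 2)%N)%:R * x ^+ (r - 2 * i).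

Definition E_sum (m d : nat) (beta : L) : int :=
  \sum_(x : L | inSub m x) sgn (trace1 m (beta * dickson d x)).

Definition fdef (m d l : nat) (a0 a1 : L) (x : L) : L :=
  \sum_(i < d) trace1 (2 * m) ((if i == 0 :> nat then a0 else a1) *
       x ^+ ((l + i * ((2 ^ m + 1) %/ d)) * (2 ^ m - 1))).
End Defs.

(* Main.v *)
Require Import Defs.
From mathcomp Require Import all_boot all_order all_algebra all_field.
From mathcomp Require Import zify ring.
Import GRing.Theory Num.Theory.
Local Open Scope ring_scope.

(* Let q = 2^m, and let U and F be the groups of (q+1)-th and (q-1)-th roots of
   unity.  Since f(x) = g(x^(q-1)) and g(1) = 0, the Walsh transform is determined
   by Lam = sum_(u in U) (-1)^g(u), and f is bent iff Lam = 1.  On U the sum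
   defining g collapses to Tr(a0 u^l) if u lies in the subgroup V of e-th roots of
   unity, e = (q+1)/d, and to Tr((a0+a1) u^l) otherwise, so Lam is a combination of
   sums of (-1)^Tr(b v) over V and U.  These are evaluated by
   d * sum_V (-1)^Tr(bv) = 2 E_{m,d}(b) + 1 - K_m(b): the map x |-> x + 1/x is
   two-to-one from the disjoint union of U and F onto F_q, it turns D_d into
   x^d + x^-d, and d is coprime to q - 1, so that the part over F does not depend
   on d and gives K_m(b) - 1. *)

Section RootsOfUnity.
Variable L : finFieldType.
Implicit Types (w : L) (F G : L -> int).

Lemma prim_root_exists M : (M %| #|L|.-1)%N -> exists w, M.-primitive_root w.
Proof.
move=> dvM; have Lgt1 := finNzRing_gt1 L.
have N0 : (0 < #|L|.-1)%N by rewrite -subn1 subn_gt0.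
have /hasP[z _ pz] : has (#|L|.-1).-primitive_root (enum (predC1 (0 : L))).
  apply: cyclic.has_prim_root => //; last 2 first.
  - exact: enum_uniq.
  - by rewrite -cardE cardC1.
  apply/allP => x; rewrite mem_enum inE => x0; apply/unity_rootP.
  apply: (mulfI x0); rewrite -exprS prednK; last by rewrite ltnW.
  by rewrite mulr1 expf_card.
by exists (z ^+ (#|L|.-1 %/ M)); apply: dvdn_prim_root.
Qed.

Lemma sum_prim_root M w F : M.-primitive_root w ->
  \sum_(y | y ^+ M == 1) F y = \sum_(0 <= i < M) F (w ^+ i).
Proof.
move=> pw; have M0 := prim_order_gt0 pw.
case: M pw M0 => // M pw _; rewrite big_mkord.
pose h (i : 'I_M.+1) := w ^+ i.
rewrite (reindex h) /=; last first.
  exists (fun y => odflt ord0 [pick i : 'I_M.+1 | h i == y]) => x; rewrite inE => Px.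
    case: pickP => [j /eqP|/(_ x)]; last by rewrite eqxx.
    move/eqP; rewrite /h (eq_prim_root_expr pw) !modn_small ?ltn_ord //.
    by move/eqP/val_inj.
  move/eqP: Px => /(prim_rootP pw)[i ->].
  case: pickP => [j /eqP //|/(_ i)]; by rewrite eqxx.
by apply: eq_bigl => i; rewrite /h -exprM mulnC exprM (prim_expr_order pw) expr1n eqxx.
Qed.

Lemma sum_root_card M : (M %| #|L|.-1)%N -> \sum_(y : L | y ^+ M == 1) (1 : int) = M%:Z.
Proof.
move=> /prim_root_exists[w pw].
by rewrite (sum_prim_root _ _ (fun=> 1) pw) sumr_const_nat subn0 natz.
Qed.

Lemma sum_periodic (k M : nat) (G : nat -> int) :
  (forall i, G (i + M)%N = G i) ->
  \sum_(0 <= i < k * M) G i = k%:Z * \sum_(0 <= i < M) G i.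
Proof.
move=> perG; elim: k => [|k IHk]; first by rewrite mul0n big_geq // mul0r.
rewrite mulSn (@big_cat_nat _ _ _ M) ?leq_addr //=.
rewrite -{2}[M]add0n big_addn addKn (eq_bigr _ (fun i _ => perG i)).
by rewrite IHk -addn1 PoszD mulrDl mul1r addrC.
Qed.

Lemma sum_root_dvd k M F : (0 < k)%N -> (k * M %| #|L|.-1)%N ->
  \sum_(y | y ^+ (k * M) == 1) F (y ^+ k) = k%:Z * \sum_(y | y ^+ M == 1) F y.
Proof.
move=> k0 /prim_root_exists[w pw].
have M0 : (0 < M)%N by have := prim_order_gt0 pw; rewrite muln_gt0 k0.
have pwk : M.-primitive_root (w ^+ k).
  by have := exp_prim_root pw k; rewrite gcdnMr mulKn.
rewrite (sum_prim_root _ _ _ pw) (sum_prim_root _ _ _ pwk) -sum_periodic.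
  by apply: eq_bigr => i _; rewrite -!exprM mulnC.
by move=> i; rewrite exprD (prim_expr_order pwk) mulr1.
Qed.

Lemma sum_root_coprime k M F : (0 < M)%N -> coprime k M ->
  \sum_(y | y ^+ M == 1) F (y ^+ k) = \sum_(y | y ^+ M == 1) F y.
Proof.
case: M => [//|[|M]] _ cokM.
  by apply: eq_bigr => y; rewrite expr1 => /eqP ->; rewrite expr1n.
have k0 : (0 < k)%N by case: k cokM => //; rewrite /coprime gcd0n.
have [j Hj] : exists j, (k * j = 1 %[mod M.+2])%N.
  case: (egcdnP M.+2 k0) => a b; rewrite (eqP cokM) => ab _.
  by exists a; rewrite mulnC ab modnMDl.
have inv y : y ^+ M.+2 == 1 -> (y ^+ k) ^+ j = y.
  move=> /eqP y1; rewrite -exprM (divn_eq (k * j) M.+2) exprD mulnC exprM y1.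
  by rewrite expr1n mul1r Hj modn_small.
rewrite [RHS](reindex_onto (fun y => y ^+ k) (fun y => y ^+ j)); last first.
  by move=> y /inv; rewrite -!exprM mulnC.
apply: eq_bigl => y /=; apply/idP/andP => [y1|[y1 /eqP <-]].
  by rewrite inv // eqxx -exprM mulnC exprM (eqP y1) expr1n.
by rewrite -exprM mulnC exprM (eqP y1) expr1n.
Qed.
End RootsOfUnity.

Section Dickson.
Variable L : finFieldType.
Hypothesis char2 : 2 \in [pchar L].

Lemma dickson_coefE r i : (0 < r)%N -> (i.*2.+2 <= r)%N ->
  dickson_coef r i.+1 = ('C(r - i.+1, i.+1) + 'C(r - i.+2, i))%N.
Proof.
move=> r0 ir; rewrite /dickson_coef.
have p0 : (0 < r - i.+1)%N by lia.
rewrite -[RHS](mulnK _ p0); congr (_ %/ _)%N.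
have H := mul_bin_diag (r - i.+1) i.
have E : (r - i.+1).-1 = (r - i.+2)%N by lia.
rewrite mulnDl [('C(r - i.+2, i) * _)%N]mulnC -E H [('C(r - i.+1, i.+1) * _)%N]mulnC -mulnDl.
by congr (_ * _)%N; lia.
Qed.

(* Fibonacci polynomials satisfy D_r = F_r + F_(r-2) mod 2, which yields the
   three-term recursion for D_r. *)
Definition fibpoly (n : nat) (x : L) : L :=
  \sum_(0 <= i < n.+1) 'C(n - i, i)%:R * x ^+ (n - i.*2).

Lemma fibpolyE n N x : (n./2 < N)%N ->
  fibpoly n x = \sum_(0 <= i < N) 'C(n - i, i)%:R * x ^+ (n - i.*2).
Proof.
move=> ltN.
have H K : (n./2 < K)%N -> \sum_(0 <= i < K) 'C(n - i, i)%:R * x ^+ (n - i.*2) =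
  \sum_(0 <= i < n./2.+1) 'C(n - i, i)%:R * x ^+ (n - i.*2).
  move=> ltK; rewrite (@big_cat_nat _ _ _ n./2.+1) //= [X in _ + X]big_nat_cond.
  rewrite [X in _ + X]big1 ?addr0 // => i; rewrite andbT => /andP[ni _].
  by rewrite bin_small ?mul0r //; lia.
by rewrite /fibpoly H ?[RHS]H //; lia.
Qed.

Lemma fibpolyS n x : fibpoly n.+2 x = x * fibpoly n.+1 x + fibpoly n x.
Proof.
rewrite (@fibpolyE n.+2 n.+3) ?(@fibpolyE n.+1 n.+3) ?(@fibpolyE n n.+2) //; try lia.
rewrite [LHS]big_nat_recl // [in RHS]big_nat_recl // !subn0 !bin0 mul1r mul1r.
rewrite mulrDr -exprS -addrA; congr (_ + _).
rewrite mulr_sumr -big_split /=; apply: eq_big_nat => i /andP[_ lti].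
have -> : (n.+2 - i.+1.*2 = n - i.*2)%N by lia.
have -> : (n.+1 - i.+1.*2 = n - i.*2.+1)%N by lia.
rewrite !subSS.
case: (leqP i.*2 n) => [le|gt]; last first.
  rewrite !bin_small ?mul0r ?mulr0 ?addr0 //; lia.
have -> : (n.+1 - i = (n - i).+1)%N by lia.
rewrite binS natrD mulrDl; congr (_ + _).
case: (leqP i.*2.+1 n) => [le'|gt].
  by rewrite mulrCA -exprS; congr (_ * _ ^+ _); lia.
by rewrite bin_small ?mul0r ?mulr0 //; lia.
Qed.

Lemma dickson_fib r x : dickson r.+2 x = fibpoly r.+2 x + fibpoly r x.
Proof.
have r2 : (r.+2 %/ 2 = r./2.+1)%N by lia.
rewrite (@fibpolyE r.+2 (r.+2 %/ 2).+1) ?(@fibpolyE r (r.+2 %/ 2)); try lia.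
rewrite /dickson -(big_mkord xpredT
  (fun i => ((dickson_coef r.+2 i %% 2)%N)%:R * x ^+ (r.+2 - 2 * i))).
rewrite [LHS]big_nat_recl // [in RHS]big_nat_recl // -addrA; congr (_ + _).
  by rewrite /dickson_coef !subn0 bin0 muln1 divnn.
rewrite -big_split; apply: eq_big_nat => i /andP[_ lti] /=.
rewrite dickson_coefE; [|by []|by lia].
have -> : (r.+2 - i.+1 = r.+1 - i)%N by lia.
have -> : (r.+2 - i.+2 = r - i)%N by lia.
have -> : (r.+2 - 2 * i.+1 = r - i.*2)%N by lia.
have -> : (r.+2 - i.+1.*2 = r - i.*2)%N by lia.
by rewrite (GRing.natr_mod_pchar char2) natrD mulrDl.
Qed.

Lemma fibpoly0 x : fibpoly 0 x = 1.
Proof. by rewrite /fibpoly big_nat1 mulr1. Qed.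

Lemma fibpoly1 x : fibpoly 1 x = x.
Proof. by rewrite (@fibpolyE 1 1) // big_nat1 mul1r. Qed.

Lemma dickson1 (x : L) : dickson 1 x = x.
Proof. by rewrite /dickson big_ord1 /dickson_coef /= mul1r. Qed.

Lemma dicksonV r (x : L) : (0 < r)%N -> x != 0 ->
  dickson r (x + x^-1) = x ^+ r + x^-1 ^+ r.
Proof.
case: r => [//|[|r]] _ x0; first by rewrite dickson1.
have c2 := addrr_pchar2 char2; have xy := mulfV x0.
rewrite dickson_fib; move: (x^-1) xy => y xy.
elim/ltn_ind: r => -[|[|r]] IH.
- rewrite fibpolyS -addrA c2 addr0 fibpoly1.
  have -> : (x + y) * (x + y) = x ^+ 2 + y ^+ 2 + (x * y + x * y) by ring.
  by rewrite c2 addr0.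
- rewrite fibpolyS -addrA c2 addr0 fibpolyS fibpoly1 fibpoly0.
  have -> : (x + y) * ((x + y) * (x + y) + 1) =
     x ^+ 3 + y ^+ 3 + (x + y) * (1 + (x * y + (x * y + x * y))) by ring.
  by rewrite c2 xy addr0 c2 mulr0 addr0.
rewrite fibpolyS [X in _ + X]fibpolyS addrACA -mulrDr !IH //.
have -> : (x + y) * (x ^+ r.+3 + y ^+ r.+3) + (x ^+ r.+2 + y ^+ r.+2) =
   x ^+ r.+4 + y ^+ r.+4 + (x * y * (x ^+ r.+2 + y ^+ r.+2) + (x ^+ r.+2 + y ^+ r.+2)).
  by rewrite !exprS; ring.
by rewrite xy mul1r c2 addr0.
Qed.
End Dickson.

Section Trace.
Variable L : finFieldType.
Hypothesis char2 : 2 \in [pchar L].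
Implicit Types (x y t : L) (k : nat).

Lemma frobD k x y : (x + y) ^+ (2 ^ k) = x ^+ (2 ^ k) + y ^+ (2 ^ k).
Proof.
apply: GRing.exprDn_pchar.
by rewrite pnatX pnatE // char2.
Qed.

Lemma inSub0 k : inSub k (0 : L).
Proof. by rewrite /inSub expr0n expn_eq0. Qed.

Lemma inSubD k x y : inSub k x -> inSub k y -> inSub k (x + y).
Proof. by rewrite /inSub frobD => /eqP -> /eqP ->. Qed.

Lemma inSubM k x y : inSub k x -> inSub k y -> inSub k (x * y).
Proof. by rewrite /inSub exprMn => /eqP -> /eqP ->. Qed.

Lemma inSubV k x : inSub k x -> inSub k x^-1.
Proof. by rewrite /inSub exprVn => /eqP ->. Qed.

Lemma inSub_sum k (I : finType) (F : I -> L) :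
  (forall i, inSub k (F i)) -> inSub k (\sum_i F i).
Proof.
by move=> H; apply: (big_ind (fun x => inSub k x)) => //; [exact: inSub0|exact: inSubD].
Qed.

Lemma bitP t : inSub 1 t -> t = 0 \/ t = 1.
Proof.
move=> /eqP t2; have /eqP : t * (t - 1) = 0 by rewrite mulrBr -expr2 t2 mulr1 subrr.
by rewrite mulf_eq0 subr_eq0 => /orP[/eqP|/eqP]; [left|right].
Qed.

Lemma sgn0 : sgn (0 : L) = 1.
Proof. by rewrite /sgn eqxx. Qed.

Lemma sgnD x y : inSub 1 x -> inSub 1 y -> sgn (x + y) = sgn x * sgn y.
Proof.
rewrite /sgn => /bitP[]-> /bitP[]->; rewrite ?addr0 ?add0r ?(addrr_pchar2 char2).
all: by rewrite ?eqxx ?oner_eq0.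
Qed.

Lemma trace10 k : trace1 k (0 : L) = 0.
Proof. by rewrite /trace1 big1 // => i _; apply/eqP; exact: inSub0. Qed.

Lemma trace1D k x y : trace1 k (x + y) = trace1 k x + trace1 k y.
Proof. by rewrite /trace1 -big_split; apply: eq_bigr => i _; rewrite frobD. Qed.

Lemma trace1_sqr k x : trace1 k (x ^+ 2) = trace1 k x ^+ 2.
Proof.
rewrite /trace1 (big_morph (fun z : L => z ^+ 2) (id1 := 0) (op1 := +%R)).
- by apply: eq_bigr => i _; rewrite -!exprM mulnC.
- exact: (frobD 1).
- by rewrite expr0n.
Qed.

Lemma trace1_frob k x : inSub k x -> trace1 k (x ^+ 2) = trace1 k x.
Proof.
move=> /eqP xk.
have : x + trace1 k (x ^+ 2) = trace1 k x + x ^+ (2 ^ k).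
  rewrite /trace1 -(big_ord_recr k (fun i => x ^+ (2 ^ i)))  big_ord_recl /=.
  by congr (_ + _); apply: eq_bigr => i _; rewrite -exprM -expnS.
by rewrite xk addrC => /(@addIr _ x).
Qed.

Lemma trace1_bit k x : inSub k x -> inSub 1 (trace1 k x).
Proof. by move=> xk; rewrite /inSub -trace1_sqr trace1_frob. Qed.

Lemma trace1_double k x : trace1 (2 * k) x = trace1 k (x + x ^+ (2 ^ k)).
Proof.
rewrite mul2n -addnn trace1D /trace1 big_split_ord /=; congr (_ + _).
by apply: eq_bigr => i _; rewrite expnD exprM.
Qed.

Lemma trace1_bigM k (I : finType) (F : I -> L) :
  \sum_i trace1 k (F i) = trace1 k (\sum_i F i).
Proof. by rewrite (big_morph (trace1 k) (trace1D k) (trace10 k)). Qed.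

Lemma sgn_trace1D k x y : inSub k x -> inSub k y ->
  sgn (trace1 k (x + y)) = sgn (trace1 k x) * sgn (trace1 k y).
Proof. by move=> xk yk; rewrite trace1D sgnD ?trace1_bit. Qed.
End Trace.

Section Field.
Variables (L : finFieldType) (m : nat).
Hypotheses (m0 : (0 < m)%N) (cardL : #|L| = (2 ^ (2 * m))%N).
Implicit Types (x y t b c : L) (F G : L -> int).
Notation q := (2 ^ m)%N.

Lemma pchar2 : 2 \in [pchar L].
Proof. exact: card_finPcharP cardL _. Qed.
Let char2 := pchar2.

Lemma q_gt1 : (1 < q)%N. Proof. by rewrite -{1}(expn0 2) ltn_exp2l. Qed.

Lemma q_even : ~~ odd q. Proof. by rewrite oddX orbF -lt0n m0. Qed.

Lemma cardL_predE : #|L|.-1 = ((q - 1) * (q + 1))%N.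
Proof. by rewrite cardL mulnC expnM; have := q_gt1; move: q => k; nia. Qed.

Lemma inSub_full x : inSub (2 * m) x.
Proof. by rewrite /inSub -cardL expf_card. Qed.

Lemma inSubE x : inSub m x = (x == 0) || (x ^+ (q - 1) == 1).
Proof.
have q0 : (0 < q - 1)%N by rewrite subn_gt0 q_gt1.
have [->|x0] := eqVneq x 0; first by rewrite inSub0.
rewrite /inSub -[RHS](inj_eq (mulfI x0)) mulr1 -exprS.
by rewrite subn1 prednK // ltnW ?q_gt1.
Qed.

Lemma root_neq0 k x : (0 < k)%N -> x ^+ k == 1 -> x != 0.
Proof. by move=> k0; apply: contraTneq => ->; rewrite expr0n eqn0Ngt k0 eq_sym oner_eq0. Qed.

Lemma sum_inSub F :
  \sum_(x | inSub m x) F x = F 0 + \sum_(x | x ^+ (q - 1) == 1) F x.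
Proof.
have q0 : (0 < q - 1)%N by rewrite subn_gt0 q_gt1.
rewrite (bigD1 0) ?inSub0 //=; congr (_ + _); apply: eq_bigl => x.
rewrite inSubE; have [->|x0] /= := eqVneq x 0; last by rewrite andbT.
by rewrite expr0n eqn0Ngt q0 eq_sym oner_eq0.
Qed.

Lemma neq0_rootE x : (x ^+ ((q - 1) * (q + 1)) == 1) = (x != 0).
Proof.
have q1 := q_gt1; have N0 : (0 < #|L|.-1)%N by rewrite cardL_predE; nia.
rewrite -cardL_predE; apply/idP/idP => [|x0]; first exact: root_neq0.
by rewrite -(inj_eq (mulfI x0)) mulr1 -exprS prednK ?expf_card //; lia.
Qed.

Lemma sum_neq0 F : \sum_x F x = F 0 + \sum_(x | x ^+ ((q - 1) * (q + 1)) == 1) F x.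
Proof.
rewrite (bigD1 0) //=; congr (_ + _); apply: eq_bigl => x.
by rewrite neq0_rootE.
Qed.

Lemma sum_inSub1 : \sum_(x : L | inSub m x) (1 : int) = q%:Z.
Proof.
rewrite sum_inSub sum_root_card; first by have := q_gt1; lia.
by rewrite cardL_predE dvdn_mulr.
Qed.

Lemma trace1_neq0 : exists2 t : L, inSub m t & trace1 m t != 0.
Proof.
apply/exists_inP; apply: contraT; rewrite negb_exists_in => /forall_inP H.
pose p : {poly L} := \sum_(i < m) 'X^(2 ^ i).
have p0 : p != 0.
  apply/negP => /eqP /(congr1 (fun p : {poly L} => p`_1)); rewrite coef0 coef_sum.
  rewrite (bigD1 (Ordinal m0)) //= big1 ?addr0 ?coefXn ?expn0 => [/eqP|i].
    by rewrite oner_eq0.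
  rewrite -val_eqE /= -lt0n => i0; rewrite coefXn.
  by rewrite -(expn0 2) eqn_exp2l // eq_sym eqn0Ngt i0.
have szp : (size p <= (2 ^ m.-1).+1)%N.
  apply: leq_trans (size_sum _ _ _) _; apply/bigmax_leqP => i _.
  by rewrite size_polyXn ltnS leq_exp2l // -ltnS prednK.
have := @max_poly_roots _ p (enum [pred x | inSub m x]) p0.
rewrite enum_uniq => /(_ _ isT).
rewrite -cardE; have -> : #|[pred x : L | inSub m x]| = q.
  apply/eqP; rewrite -(eqr_nat int) -sum1_card natr_sum; apply/eqP.
  by rewrite [RHS]natz -sum_inSub1.
move=> Hq; suff : (q < size p)%N.
  move/leq_trans => /(_ _ szp); rewrite -{1}(prednK m0) expnS.
  by have := expn_gt0 2 m.-1; lia.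
apply: Hq; apply/allP => x; rewrite mem_enum inE => /H; rewrite negbK /trace1 => tx.
rewrite /root horner_sum -[X in _ == X](eqP tx); apply/eqP.
by apply: eq_bigr => i _; rewrite hornerXn.
Qed.

Lemma sum_character c : inSub m c ->
  \sum_(x | inSub m x) sgn (trace1 m (c * x)) = if c == 0 then q%:Z else 0.
Proof.
move=> cm; have [->|c0] := eqVneq c 0.
  by rewrite -sum_inSub1; apply: eq_bigr => x _; rewrite mul0r trace10 /sgn eqxx.
have [t tm tr] := trace1_neq0.
set S := \sum_(_ | _) _; suff : S = - S by lia.
have bi y : inSub m y -> inSub m (y / c) by move=> ym; rewrite inSubM ?inSubV.
rewrite {1}/S (reindex_inj (addIr (t / c))) /= -sumrN.
have E x : inSub m (x + t / c) = inSub m x.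
  apply/idP/idP => xm; last by rewrite inSubD ?bi.
  have -> : x = x + t / c + t / c by rewrite -addrA (addrr_pchar2 char2) addr0.
  by rewrite inSubD ?bi.
rewrite (eq_bigl _ _ E); apply: eq_bigr => x xm.
rewrite mulrDr mulrCA divff // mulr1 sgn_trace1D ?inSubM //.
by rewrite {2}/sgn (negbTE tr) mulrN1.
Qed.
End Field.

Section Sums.
Variables (L : finFieldType) (m : nat).
Hypotheses (m0 : (0 < m)%N) (cardL : #|L| = (2 ^ (2 * m))%N).
Implicit Types (x y t b c : L) (F G : L -> int).
Notation q := (2 ^ m)%N.
Let char2 : 2 \in [pchar L] := pchar2 L m cardL.
Let q1 : (1 < q)%N := q_gt1 m m0.

Lemma dvdU : (q + 1 %| #|L|.-1)%N.
Proof. by rewrite (cardL_predE L m) // dvdn_mull. Qed.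

Lemma dvdF : (q - 1 %| #|L|.-1)%N.
Proof. by rewrite (cardL_predE L m) // dvdn_mulr. Qed.

Lemma unit_inv x : x ^+ (q + 1) == 1 -> x ^+ q = x^-1.
Proof.
move=> xU; have x0 : x != 0 by apply: root_neq0 xU; rewrite addn1.
by apply: (mulIf x0); rewrite mulVf // -exprSr -addn1 (eqP xU).
Qed.

Lemma inSub_addV x : (x ^+ (q + 1) == 1) || (x ^+ (q - 1) == 1) -> inSub m (x + x^-1).
Proof.
case/orP => [xU|xq]; last first.
  have xm : inSub m x by rewrite inSubE // xq orbT.
  by rewrite inSubD ?inSubV.
by rewrite /inSub frobD // exprVn unit_inv // invrK addrC.
Qed.

(* The two groups share the element 1, hence multiplicities. *)
Let weight x : nat := ((x ^+ (q + 1)%N == 1)%R + (x ^+ (q - 1)%N == 1)%R)%N.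
Let fiber c : nat := \sum_(x | x + x^-1 == c) weight x.

Lemma weightV x : weight x^-1 = weight x.
Proof. by rewrite /weight !exprVn !invr_eq1. Qed.

Lemma weight_gt0 x : (0 < weight x)%N = (x ^+ (q + 1) == 1) || (x ^+ (q - 1) == 1).
Proof. by rewrite /weight addn_gt0 !lt0b. Qed.

Lemma weight_neq0 x : (0 < weight x)%N -> x != 0.
Proof.
rewrite weight_gt0 => /orP[|]; apply: root_neq0; first by rewrite addn1.
by rewrite subn_gt0.
Qed.

Lemma weight_le1 x : x != x^-1 -> (weight x <= 1)%N.
Proof.
move=> xV; rewrite /weight; case: eqP => // x1; case: eqP => // x2; case/eqP: xV.
have x0 : x != 0 by apply: (@root_neq0 _ (q + 1)); rewrite ?x1 ?eqxx ?addn1.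
apply: (mulfI x0); rewrite mulfV // -expr2.
have -> : (x ^+ 2 = x ^+ (q - 1) * x ^+ 2) by rewrite x2 mul1r.
by rewrite -exprD -x1; congr (_ ^+ _); lia.
Qed.

Lemma fiber_le2 c : (fiber c <= 2)%N.
Proof.
rewrite /fiber.
case: (pickP [pred x | (x + x^-1 == c) && (0 < weight x)%N]) => [x|H]; last first.
  rewrite big1 // => x xc; have := H x; rewrite /= xc /=.
  by case: (weight x).
move=> /andP[xc wx]; have x0 := weight_neq0 _ wx.
have other y : y + y^-1 == c -> y != x -> y != x^-1 -> weight y = 0%N.
  move=> yc yx yV; apply/eqP; rewrite -leqn0 leqNgt; apply/negP => /weight_neq0 y0.
  case/negP: yV; have : (y - x) * (y - x^-1) = 0.
    have -> : (y - x) * (y - x^-1) = y * (y + y^-1 - (x + x^-1)).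
      by field; rewrite x0 y0.
    by rewrite (eqP yc) (eqP xc) subrr mulr0.
  move/eqP; rewrite mulf_eq0 !subr_eq0 => /orP[] //.
  by rewrite (negbTE yx).
rewrite (bigD1 x) //=; have [xV|xV] := eqVneq x x^-1.
  rewrite big1 ?addn0; first by rewrite /weight; do 2!case: (_ == _).
  by move=> y /andP[yc yx]; rewrite other -?xV.
rewrite (bigD1 x^-1) /=; last by rewrite invrK addrC xc eq_sym.
rewrite big1 ?addn0; last by move=> y /andP[/andP[yc yx] yV]; rewrite other.
by rewrite weightV; have := weight_le1 _ xV; lia.
Qed.

Lemma sum_addV_fiber G :
  \sum_(x | x ^+ (q + 1) == 1) G (x + x^-1) +
  \sum_(x | x ^+ (q - 1) == 1) G (x + x^-1) =
  \sum_(c | inSub m c) (fiber c)%:Z * G c.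
Proof.
rewrite big_mkcond [X in _ + X]big_mkcond -big_split /=.
transitivity (\sum_x (weight x)%:Z * G (x + x^-1)).
  apply: eq_bigr => x _; rewrite /weight.
  by rewrite PoszD mulrDl; do 2!case: (_ == _); rewrite /= ?mul1r ?mul0r.
rewrite (partition_big (fun x => x + x^-1) xpredT) //= [RHS]big_mkcond /=.
apply: eq_bigr => c _; transitivity ((fiber c)%:Z * G c).
  rewrite /fiber -natz natr_sum mulr_suml; apply: eq_bigr => x /eqP <-.
  by rewrite natz.
case: ifP => // cm; rewrite /fiber big1 ?mul0r // => x /eqP xc.
apply/eqP; rewrite -leqn0 leqNgt weight_gt0; apply/negP => /inSub_addV.
by rewrite xc cm.
Qed.

(* Every fiber over the subfield has weight at most 2, and the total weight
   (q + 1) + (q - 1) is twice the number q of points, so all weights are 2. *)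
Lemma sum_addV G :
  \sum_(x | x ^+ (q + 1) == 1) G (x + x^-1) +
  \sum_(x | x ^+ (q - 1) == 1) G (x + x^-1) =
  2 * \sum_(c | inSub m c) G c.
Proof.
rewrite sum_addV_fiber mulr_sumr; apply: eq_bigr => c cm; congr (_ * _).
have H : \sum_(c | inSub m c) (2 - (fiber c)%:Z) = 0 :> int.
  rewrite big_split /= sumrN.
  have := sum_addV_fiber (fun=> 1); rewrite !sum_root_card ?dvdU ?dvdF //.
  under [X in _ = X -> _]eq_bigr do rewrite mulr1.
  move=> <-; have := sum_inSub1 L m m0 cardL.
  have -> : \sum_(i : L | inSub m i) (2 : int) = 2 * \sum_(i : L | inSub m i) 1.
    by rewrite mulr_sumr; apply: eq_bigr => i _; rewrite mulr1.
  move=> ->; move: (2 ^ m)%N q1 => k; lia.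
apply/esym/eqP; rewrite -subr_eq0; apply/eqP.
apply: (psumr_eq0P _ H) => // i _; by have := fiber_le2 i; lia.
Qed.

Lemma sum_mu b k : inSub m b ->
  \sum_(x | x ^+ (q + 1) == 1) sgn (trace1 (2 * m) (b * x ^+ k)) =
  \sum_(x | x ^+ (q + 1) == 1) sgn (trace1 m (b * (x ^+ k + x^-1 ^+ k))).
Proof.
move=> /eqP bm; apply: eq_bigr => x xU; rewrite trace1_double // exprMn bm.
by rewrite -exprM mulnC exprM unit_inv // mulrDr.
Qed.

Lemma sum_reindex_mul c F : inSub m c -> c != 0 ->
  \sum_(x | x ^+ (q - 1) == 1) F (c * x) = \sum_(x | x ^+ (q - 1) == 1) F x.
Proof.
move=> cm c0; rewrite [RHS](reindex_inj (mulfI c0)) /=; apply: eq_bigl => x.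
move: cm; rewrite inSubE // (negbTE c0) => /eqP c1.
by rewrite exprMn c1 mul1r.
Qed.

(* Tr(y^2) = Tr(y) turns Tr(bx + 1/x) into Tr(b^2 x + 1/x), up to squaring x;
   then x is replaced by x / b. *)
Lemma kloostermanE b : inSub m b -> b != 0 ->
  \sum_(x | x ^+ (q - 1) == 1) sgn (trace1 m (b * (x + x^-1))) = kloosterman m b - 1.
Proof.
move=> bm b0; rewrite /kloosterman sum_inSub // mulr0 invr0 addr0 trace10 //.
rewrite sgn0 [1 + _]addrC addrK.
pose H x := sgn (trace1 m (b ^+ 2 * x + x^-1)).
have b2 : inSub m (b ^+ 2) by rewrite expr2 inSubM.
have qm x : x ^+ (q - 1) == 1 -> inSub m x by move=> xq; rewrite inSubE // xq orbT.
transitivity (\sum_(x | x ^+ (q - 1) == 1) H (b^-1 * x)).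
  apply: eq_bigr => x xq; rewrite /H; congr (sgn (trace1 m _)).
  have x0 : x != 0 by apply: root_neq0 xq; rewrite subn_gt0.
  by field; rewrite x0 b0.
rewrite sum_reindex_mul ?invr_eq0 ?inSubV // -(sum_root_coprime _ 2); first last.
- by rewrite coprime2n oddB ?(negbTE (q_even m m0)) // ltnW.
- by rewrite subn_gt0.
apply: eq_bigr => x /qm xm; rewrite -[in RHS]trace1_frob ?inSubD ?inSubM ?inSubV //.
by rewrite /H expr2 (frobD L char2 1) exprMn exprVn.
Qed.

Lemma sum_root_V b d : inSub m b -> b != 0 -> (0 < d)%N -> (d %| q + 1)%N ->
  d%:Z * \sum_(v | v ^+ ((q + 1) %/ d) == 1) sgn (trace1 (2 * m) (b * v)) =
  2 * E_sum m d b + 1 - kloosterman m b.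
Proof.
move=> bm b0 d0 dq; set e := ((q + 1) %/ d)%N.
have de : (d * e = q + 1)%N by rewrite mulnC divnK.
rewrite -(sum_root_dvd _ d e (fun v => sgn (trace1 (2 * m) (b * v)))) //; last first.
  by rewrite de (cardL_predE L m) // dvdn_mull.
rewrite de sum_mu //.
have dick x k : (0 < k)%N -> x ^+ k == 1 -> dickson d (x + x^-1) = x ^+ d + x^-1 ^+ d.
  by move=> k0 xk; rewrite dicksonV // (root_neq0 _ _ _ k0 xk).
have := sum_addV (fun c => sgn (trace1 m (b * dickson d c))).
rewrite -/(E_sum m d b) => <-.
rewrite -addrA -[LHS]addr0 -addrA; congr (_ + _).
  by apply: eq_bigr => x xU; rewrite (dick _ _ _ xU) ?addn1.
apply/esym/eqP; rewrite addrA subr_eq0 eq_sym -subr_eq -kloostermanE //; apply/eqP/esym.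
transitivity (\sum_(x | x ^+ (q - 1) == 1) sgn (trace1 m (b * (x ^+ d + (x ^+ d)^-1)))).
  by apply: eq_bigr => x xF; rewrite (dick _ _ _ xF) ?subn_gt0 // exprVn.
rewrite (sum_root_coprime _ d _ (fun x => sgn (trace1 m (b * (x + x^-1))))) ?subn_gt0 //.
apply: coprime_dvdl dq _.
have -> : (q + 1 = 2 + (q - 1))%N by lia.
rewrite coprime_sym /coprime gcdnDr -/(coprime _ 2) coprimen2.
by rewrite oddB ?(negbTE (q_even m m0)) // ltnW.
Qed.
End Sums.

Section Bent.
Variables (L : finFieldType) (m : nat).
Hypotheses (m0 : (0 < m)%N) (cardL : #|L| = (2 ^ (2 * m))%N).
Implicit Types (x y t b c : L) (F G : L -> int).
Notation q := (2 ^ m)%N.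
Let char2 : 2 \in [pchar L] := pchar2 L m cardL.
Let q1 : (1 < q)%N := q_gt1 m m0.
Let q10 : (0 < q - 1)%N. Proof. by rewrite subn_gt0. Qed.

Lemma sum_root_trace y :
  \sum_(t | t ^+ (q - 1) == 1) sgn (trace1 (2 * m) (y * t)) =
  (if y ^+ q == y then q%:Z else 0) - 1.
Proof.
have c_in : inSub m (y + y ^+ q).
  by rewrite /inSub frobD // -exprM -expnD addnn -mul2n -cardL expf_card addrC.
have := sum_character L m m0 cardL _ c_in; rewrite sum_inSub // mulr0 trace10 //.
rewrite [y + _]addrC -(subr_eq0 (y ^+ q)) (oppr_pchar2 char2) => <-.
rewrite sgn0 [1 + _]addrC addrK; apply: eq_bigr => t tF.
have /eqP tq : inSub m t by rewrite inSubE // tF orbT.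
by rewrite trace1_double // exprMn tq -mulrDl [y + _]addrC.
Qed.

Section Function.
Variables (f g : L -> L).
Hypotheses (gbit : forall y, inSub 1 (g y)) (g0 : g 0 = 0) (g1 : g 1 = 0).
Hypothesis fE : forall x, f x = g (x ^+ (q - 1)).
Let Lam := \sum_(u | u ^+ (q + 1) == 1) sgn (g u).

Lemma f0 : f 0 = 0.
Proof. by rewrite fE expr0n eqn0Ngt q10. Qed.

Lemma sum_f : \sum_(x | x ^+ ((q - 1) * (q + 1)) == 1) sgn (f x) = (q%:Z - 1) * Lam.
Proof.
under eq_bigr do rewrite fE.
rewrite (sum_root_dvd _ (q - 1) (q + 1) (fun y => sgn (g y))) // -?(cardL_predE L m) //.
by rewrite -subzn // ltnW.
Qed.

Lemma walsh0 : walsh (2 * m) f 0 = 1 + (q%:Z - 1) * Lam.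
Proof.
rewrite /walsh (eq_bigr (fun x => sgn (f x))); last by move=> x _; rewrite mul0r trace10 // addr0.
by rewrite (sum_neq0 L m) // sum_f f0 sgn0.
Qed.

(* [f] is invariant under multiplication by nonzero subfield elements; averaging
   over them leaves only the line where [c * x] lies in the subfield. *)
Lemma walsh_neq0 c : c != 0 ->
  walsh (2 * m) f c = 1 - Lam + q%:Z * sgn (f c^-1).
Proof.
move=> c0; have q10Z : (q - 1)%N%:Z = q%:Z - 1 by rewrite -subzn // ltnW.
have fM t x : t ^+ (q - 1) == 1 -> f (t * x) = f x.
  by move=> /eqP t1; rewrite !fE exprMn t1 mul1r.
rewrite /walsh (sum_neq0 L m) // f0 mulr0 trace10 // addr0 sgn0 -addrA; congr (_ + _).
set S := \sum_(_ | _) _.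
have ES t : t ^+ (q - 1) == 1 ->
    S = \sum_(x | x ^+ ((q - 1) * (q + 1)) == 1) sgn (f x) * sgn (trace1 (2 * m) (c * x * t)).
  move=> t1; have t0 : t != 0 := root_neq0 _ _ _ q10 t1.
  rewrite /S (reindex_inj (mulfI t0)) /=; apply: eq_big => x.
    by rewrite exprMn [t ^+ _]exprM (eqP t1) expr1n mul1r.
  move=> _; rewrite sgnD // ?fE ?gbit ?trace1_bit ?(inSub_full L m) // -!fE fM //.
  by rewrite mulrCA mulrA [t * _]mulrC [_ * t]mulrC mulrA [t * c]mulrC.
have : (q%:Z - 1) * S = (q%:Z - 1) * (- Lam + q%:Z * sgn (f c^-1)); last first.
  by apply: mulfI; rewrite -q10Z; lia.
transitivity (\sum_(t : L | t ^+ (q - 1) == 1) S).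
  by rewrite -[S in RHS]mul1r -mulr_suml sum_root_card ?q10Z // (dvdF L m).
rewrite (eq_bigr _ ES) exchange_big /=.
under eq_bigr do rewrite -mulr_sumr sum_root_trace mulrBr mulr1.
rewrite sumrB sum_f mulrDr mulrN addrC; congr (_ + _).
rewrite -q10Z -(sum_root_card L (q - 1)) ?(dvdF L m) // mulr_suml.
under [RHS]eq_bigr do rewrite mul1r.
rewrite (reindex_inj (mulfI (invr_neq0 c0))) /= [RHS]big_mkcond [LHS]big_mkcond /=.
apply: eq_bigr => y _; have cy : c * (c^-1 * y) = y by rewrite mulrA divff // mul1r.
rewrite cy -[y ^+ q == y]/(inSub m y) inSubE //; have [->|y0] := eqVneq y 0.
  by rewrite mulr0 f0 !expr0n !eqn0Ngt muln_gt0 q10 addn1 /= eq_sym oner_eq0.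
rewrite /=; case: (boolP (y ^+ (q - 1) == 1)) => [y1|_]; last by rewrite mulr0 if_same.
rewrite (neq0_rootE L m) // mulf_neq0 ?invr_eq0 //.
by rewrite mulrC [c^-1 * y]mulrC fM.
Qed.

(* Excludes the spurious solution q = 2, Lam = -3 of walsh(0) = -q; it rests on
   g 1 = 0. *)
Lemma Lam_ge : 1 - q%:Z <= Lam.
Proof.
have : 2 <= \sum_(u : L | u ^+ (q + 1) == 1) (sgn (g u) + 1).
  rewrite (bigD1 1) ?expr1n //= g1 sgn0 lerDl sumr_ge0 // => u _.
  by rewrite /sgn; case: ifP.
rewrite big_split /= sum_root_card ?(dvdU L m) // -/Lam; lia.
Qed.

Lemma bentE : bent (2 * m) f <-> Lam = 1.
Proof.
have sq : (2 ^ (2 * m))%N%:Z = q%:Z ^+ 2 by rewrite mulnC expnM PoszM.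
split=> [/(_ 0)|L1 c].
  rewrite walsh0 sq => /eqP; rewrite eqf_sqr => /orP[]/eqP.
    move=> H; have q0 : q%:Z - 1 != 0 by lia.
    by apply: (mulfI q0); lia.
  move=> H; exfalso; have := Lam_ge; have := q_even m m0; move: q1 H.
  move: Lam (2 ^ m)%N => lam k k1 H ek lamge.
  have : (k%:Z - 1) * (lam + 1) = - 2 by lia.
  have [k2|k4] : k = 2%N \/ (4 <= k)%N by lia.
    by rewrite k2 in lamge *; lia.
  have [|] : lam + 1 <= -1 \/ 0 <= lam + 1 by lia.
    nia.
  nia.
have [->|c0] := eqVneq c 0; first by rewrite walsh0 L1 sq; congr (_ ^+ 2); lia.
rewrite walsh_neq0 // L1 sq subrr add0r exprMn /sgn; case: ifP => _; lia.
Qed.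
End Function.
End Bent.

Lemma sum_geom_root (L : fieldType) d (z : L) : z ^+ d = 1 ->
  \sum_(i < d) z ^+ i = if z == 1 then d%:R else 0.
Proof.
move=> zd; have [->|z1] := eqVneq z 1.
  by rewrite (eq_bigr (fun=> 1)) ?sumr_const ?card_ord // => i _; rewrite expr1n.
by apply: (mulfI (x := z - 1)); rewrite ?subr_eq0 // mulr0 -subrX1 zd subrr.
Qed.

Section Main.
Variables (L : finFieldType) (m d l : nat) (a0 a1 : L).
Hypotheses (m0 : (0 < m)%N) (cardL : #|L| = (2 ^ (2 * m))%N).
Implicit Types c u v : L.
Notation q := (2 ^ m)%N.
Hypotheses (d0 : (0 < d)%N) (dq : (d %| q + 1)%N) (l0 : (0 < l)%N).
Hypothesis col : coprime l ((q + 1) %/ d).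
Hypotheses (a0m : inSub m a0) (a1m : inSub m a1).
Notation e := ((q + 1) %/ d)%N.
Notation chi y := (sgn (trace1 (2 * m) y)).
Let char2 : 2 \in [pchar L] := pchar2 L m cardL.

Let de : (d * e = q + 1)%N. Proof. by rewrite mulnC divnK. Qed.

Let coef (i : nat) := if i == 0%N then a0 else a1.
Let g (y : L) := \sum_(i < d) trace1 (2 * m) (coef i * y ^+ (l + i * e)).

Lemma fdefE x : fdef m d l a0 a1 x = g (x ^+ (q - 1)).
Proof. by apply: eq_bigr => i _; rewrite -exprM [((q - 1) * _)%N]mulnC. Qed.

Lemma g_unit u : u ^+ (q + 1) == 1 ->
  g u = trace1 (2 * m) ((if u ^+ e == 1 then a0 else a0 + a1) * u ^+ l).
Proof.
move=> /eqP uU; rewrite /g trace1_bigM //; congr trace1.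
have zd : (u ^+ e) ^+ d = 1 by rewrite -exprM mulnC de.
have d_odd : odd d.
  by apply: (dvdn_odd dq); rewrite oddD (negbTE (q_even m m0)).
under eq_bigr do rewrite exprD mulrCA.
rewrite -mulr_sumr mulrC; congr (_ * _).
have -> : \sum_(i < d) coef i * u ^+ (i * e) = a0 + a1 + a1 * \sum_(i < d) (u ^+ e) ^+ i.
  case: (d) d0 => // k _; rewrite !big_ord_recl /= !mul0n !expr0 mulrDr !mulr1.
  rewrite addrA -[a0 + a1 + a1]addrA (addrr_pchar2 char2) addr0 mulr_sumr; congr (_ + _).
  by apply: eq_bigr => i _; rewrite -exprM mulnC.
rewrite sum_geom_root //; case: ifP => _; last by rewrite mulr0 addr0.
by rewrite -(GRing.natr_mod_pchar char2) modn2 d_odd mulr1 -addrA (addrr_pchar2 char2) addr0.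
Qed.

Lemma bent_fdef : bent (2 * m) (fdef m d l a0 a1) <->
  \sum_(v | v ^+ e == 1) chi (a0 * v) - \sum_(v | v ^+ e == 1) chi ((a0 + a1) * v) +
  \sum_(u | u ^+ (q + 1) == 1) chi ((a0 + a1) * u ^+ l) = 1.
Proof.
have gbit y : inSub 1 (g y).
  by apply: inSub_sum => // i; rewrite trace1_bit // (inSub_full L m).
have g0 : g 0 = 0.
  by rewrite /g big1 // => i _; rewrite expr0n addn_eq0 eqn0Ngt l0 mulr0 trace10.
have coefm i : inSub m (coef i) by rewrite /coef; case: ifP.
have g1 : g 1 = 0.
  rewrite /g big1 // => i _; rewrite expr1n mulr1 trace1_double //.
  by rewrite (eqP (coefm i)) (addrr_pchar2 char2) trace10.
rewrite (bentE L m m0 cardL _ g gbit g0 g1 fdefE).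
set S := (X in _ <-> X = 1); suff -> : \sum_(u | u ^+ (q + 1) == 1) sgn (g u) = S by [].
rewrite {}/S.
have e0 : (0 < e)%N by move: de; case: (e) => //; rewrite muln0 addn1.
have VU v : v ^+ e == 1 -> v ^+ (q + 1) == 1.
  by move=> /eqP v1; rewrite -de mulnC exprM v1 expr1n.
have EV (F : L -> int) :
    \sum_(u | (u ^+ (q + 1) == 1) && (u ^+ e == 1)) F u = \sum_(v | v ^+ e == 1) F v.
  by apply: eq_bigl => u; rewrite andbC; apply: andb_idr => /VU.
rewrite -(sum_root_coprime L l e (fun v => chi (a0 * v))) //.
rewrite -(sum_root_coprime L l e (fun v => chi ((a0 + a1) * v))) //.
rewrite (bigID (fun u => u ^+ e == 1)) /= -!EV.
rewrite [X in _ = _ + X](bigID (fun u => u ^+ e == 1)) /= addrA subrK.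
congr (_ + _); apply: eq_bigr => u /andP[uU uV]; rewrite g_unit //.
  by rewrite uV.
by rewrite (negbTE uV).
Qed.

Lemma sum_unit_dvd c : (d %| l)%N ->
  \sum_(u | u ^+ (q + 1) == 1) chi (c * u ^+ l) =
  d%:Z * \sum_(v | v ^+ e == 1) chi (c * v).
Proof.
move=> /dvdnP[k lk].
have e0 : (0 < e)%N by move: de; case: (e) => //; rewrite muln0 addn1.
have cok : coprime k e by apply: coprime_dvdl col; rewrite lk dvdn_mulr.
rewrite -(sum_root_coprime L k e (fun v => chi (c * v))) //.
rewrite -(sum_root_dvd L d e (fun v => chi (c * v ^+ k))) ?de ?(dvdU L m) //.
by apply: eq_bigr => u _; rewrite -exprM [(d * k)%N]mulnC -lk.
Qed.

Lemma sum_unit_coprime c : inSub m c -> c != 0 -> coprime d l ->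
  \sum_(u | u ^+ (q + 1) == 1) chi (c * u ^+ l) = 1 - kloosterman m c.
Proof.
move=> cm c0 dl.
rewrite (sum_root_coprime L l (q + 1) (fun u => chi (c * u))) ?addn1 // -addn1; last first.
  by rewrite -de coprimeMr coprime_sym dl col.
have := sum_root_V L m m0 cardL c 1 cm c0 isT (dvd1n _).
rewrite divn1 mul1r => ->.
have -> : E_sum m 1 c = 0.
  rewrite /E_sum; under eq_bigr do rewrite dickson1.
  by rewrite sum_character // (negbTE c0).
by rewrite mulr0 add0r.
Qed.
End Main.

Theorem theorem2 (L : finFieldType) (m d l : nat) (a0 a1 : L) :
  (0 < m)%N ->
  #|L| = (2 ^ (2 * m))%N ->
  (0 < d)%N -> (d %| 2 ^ m + 1)%N ->
  (0 < l)%N -> coprime l ((2 ^ m + 1) %/ d) ->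
  inSub m a0 -> a0 != 0 -> inSub m a1 -> a0 != a1 ->
  ((d %| l)%N ->
     (bent (2 * m) (fdef m d l a0 a1) <->
      kloosterman m a0 + (d - 1)%:Z * kloosterman m (a0 + a1) =
      2 * (E_sum m d a0 + (d - 1)%:Z * E_sum m d (a0 + a1)))) /\
  (coprime d l ->
     (bent (2 * m) (fdef m d l a0 a1) <->
      kloosterman m a0 + (d - 1)%:Z * kloosterman m (a0 + a1) =
      2 * (E_sum m d a0 - E_sum m d (a0 + a1)))).
Proof.
move=> m0 cardL d0 dq l0 col a0m a0_neq0 a1m a01.
have char2 := pchar2 L m cardL.
have bm : inSub m (a0 + a1) by apply: inSubD.
have b0 : a0 + a1 != 0 by rewrite -[a1](oppr_pchar2 char2) subr_eq0.
have V0 := sum_root_V L m m0 cardL a0 d a0m a0_neq0 d0 dq.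
have Vb := sum_root_V L m m0 cardL (a0 + a1) d bm b0 d0 dq.
have d0Z : d%:Z != 0 by rewrite eqz_nat -lt0n.
have LamE (Lam X : int) : d%:Z * Lam = X -> (Lam = 1 <-> X = d%:Z).
  by move=> <-; split=> [->|H]; [rewrite mulr1|apply: (mulfI d0Z); rewrite mulr1].
rewrite -subzn //; split=> Hd; rewrite bent_fdef //.
  rewrite (sum_unit_dvd L m d l) // (LamE _ (2 * E_sum m d a0 + 1 - kloosterman m a0 +
    (d%:Z - 1) * (2 * E_sum m d (a0 + a1) + 1 - kloosterman m (a0 + a1)))).
    by split; lia.
  by rewrite -V0 -Vb; ring.
rewrite (sum_unit_coprime L m d l) // (LamE _ (2 * E_sum m d a0 + 1 - kloosterman m a0 -
  (2 * E_sum m d (a0 + a1) + 1 - kloosterman m (a0 + a1)) +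
  d%:Z * (1 - kloosterman m (a0 + a1)))).
  by split; lia.
by rewrite -V0 -Vb; ring.
Qed.
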